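(* Let $\mathbf{k}$, $A$, $R$ be as in the context, and assume that $A$ is commutative with an isolated singularity. Then for each graded free $R$-module $V$ there are only finitely many isomorphism classes of rigid graded maximal Cohen-Macaulay $A$-modules of type $V$.
   Context: $\mathbf{k}$ is an algebraically closed field. $A=\bigoplus_{i\ge 0}A_i$ is a non-negatively graded $\mathbf{k}$-algebra that is module-finite over its center $Z(A)$, such that $Z(A)$ is a finitely generated $\mathbf{k}$-algebra and $A_0$ is finite dimensional over $\mathbf{k}$. $R\subset Z(A)$ is a graded polynomial subring (a polynomial ring over $\mathbf{k}$ on homogeneous variables, not necessarily standard graded) over which $A$ is module-finite. (When $A$ is commutative, $Z(A)=A$.) A graded maximal Cohen-Macaulay (MCM) $A$-module is a finitely generated graded left $A$-module whose restriction to $Z(A)$ is MCM; equivalently, it is free as a (graded) $R$-module. A graded MCM $A$-module $M$ has type $V$ if $M\cong V$ as graded $R$-modules (degree-preserving isomorphism). $M$ is rigid if it has no non-split self-extensions, i.e. $\mathrm{Ext}^1_A(M,M)=0$. For $A$ commutative, $A$ has an isolated singularity if for every prime ideal $\mathfrak{p}\neq A_+:=\bigoplus_{i>0}A_i$ the localization $A_{\mathfrak p}$ is regular. *)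

(* Defs.v *)
From mathcomp Require Import all_boot all_order all_algebra.
From mathcomp Require Import mpoly.

Set Implicit Arguments.
Unset Strict Implicit.
Unset Printing Implicit Defensive.

Import GRing.Theory.
Local Open Scope ring_scope.

(** Subsets are boolean predicates, as in [ring_quotient]; classically this is
    no restriction.  Note that [idealr_closed] includes properness. *)

Definition spanned (S : nzRingType) (M : lmodType S) (s : seq M) (u : M) : Prop :=
  exists c : 'I_(size s) -> S, u = \sum_(i < size s) c i *: s`_i.

(** ** Regular local rings *)

Section Rings.
Variable B : comNzRingType.

Definition prime_ideal (P : {pred B}) : Prop :=
  idealr_closed P /\ prime_idealr_closed P.

Definition maximal_ideal (P : {pred B}) : Prop :=
  idealr_closed P /\
  forall Q : {pred B}, idealr_closed Q -> {subset P <= Q} -> {subset Q <= P}.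

Definition noetherian : Prop :=
  forall J : {pred B}, idealr_closed J ->
    exists s : seq B^o, forall b : B, b \in J <-> spanned s b.

Definition prime_chain (n : nat) : Prop :=
  exists P : nat -> {pred B},
    (forall i, (i <= n)%N -> prime_ideal (P i)) /\
    (forall i, (i < n)%N -> {subset P i <= P i.+1} /\
                            exists2 b, b \in P i.+1 & b \notin P i).

Definition krull_dim (n : nat) : Prop := prime_chain n /\ ~ prime_chain n.+1.

Definition local_ring (m : {pred B}) : Prop :=
  idealr_closed m /\ forall b, b \notin m -> exists c, b * c = 1.

Definition regular_local_ring : Prop :=
  noetherian /\
  exists m : {pred B}, local_ring m /\
  exists s : seq B^o, (forall b : B, b \in m <-> spanned s b) /\
                      krull_dim (size s).

(** ** Depth and maximal Cohen-Macaulay modules over a local ring *)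

Variable N : lmodType B.

(* u belongs to the submodule (s)N *)
Definition in_ideal_mul (s : seq B) (u : N) : Prop :=
  exists v : 'I_(size s) -> N, u = \sum_(i < size s) s`_i *: v i.

Definition regular_sequence (s : seq B) : Prop :=
  (forall i, (i < size s)%N -> forall u,
     in_ideal_mul (take i s) (s`_i *: u) -> in_ideal_mul (take i s) u) /\
  exists u, ~ in_ideal_mul s u.

Definition has_depth (m : {pred B}) (n : nat) : Prop :=
  (exists s, [/\ {subset s <= m}, regular_sequence s & size s = n]) /\
  (forall s, {subset s <= m} -> regular_sequence s -> (size s <= n)%N).

(* The zero module counts as maximal Cohen-Macaulay. *)
Definition local_mcm : Prop :=
  (forall u : N, u = 0) \/
  exists m n, [/\ local_ring m, krull_dim n & has_depth m n].

End Rings.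

(** ** Localization at a prime, up to unique isomorphism *)

Definition is_localization (A B : comNzRingType) (P : {pred A})
    (l : {rmorphism A -> B}) : Prop :=
  [/\ forall t, t \notin P -> exists c, l t * c = 1,
      forall b, exists a t, t \notin P /\ l t * b = l a
    & forall a, l a = 0 -> exists2 t, t \notin P & t * a = 0].

Definition is_mod_localization (A B : comNzRingType) (P : {pred A})
    (l : {rmorphism A -> B}) (M : lmodType A) (N : lmodType B) (h : M -> N) : Prop :=
  [/\ forall a u v, h (a *: u + v) = l a *: h u + h v,
      forall w, exists u t, t \notin P /\ l t *: w = h u
    & forall u, h u = 0 -> exists2 t, t \notin P & t *: u = 0].

Definition regular_at (A : comNzRingType) (P : {pred A}) : Prop :=
  exists (B : comNzRingType) (l : {rmorphism A -> B}),
    is_localization P l /\ regular_local_ring B.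

Definition mcm_at (A : comNzRingType) (M : lmodType A) (P : {pred A}) : Prop :=
  exists (B : comNzRingType) (l : {rmorphism A -> B}) (N : lmodType B) (h : M -> N),
    [/\ is_localization P l, is_mod_localization P l h & local_mcm N].

Definition mcm (A : comNzRingType) (M : lmodType A) : Prop :=
  (exists s : seq M, forall u, spanned s u) /\
  forall P : {pred A}, maximal_ideal P -> mcm_at M P.

(** ** Gradings *)

Definition direct_sum (I : eqType) (U : zmodType) (U_ : I -> {pred U}) : Prop :=
  (forall u, exists (s : seq I) (f : I -> U),
     (forall i, f i \in U_ i) /\ u = \sum_(i <- s) f i) /\
  (forall (s : seq I) (f : I -> U), uniq s -> (forall i, f i \in U_ i) ->
     \sum_(i <- s) f i = 0 -> forall i, i \in s -> f i = 0).

Definition graded_algebra (k : fieldType) (A : comAlgType k)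
    (A_ : nat -> {pred A}) : Prop :=
  [/\ forall i, submod_closed (A_ i),
      direct_sum A_,
      1 \in A_ 0%N
    & forall i j a b, a \in A_ i -> b \in A_ j -> a * b \in A_ (i + j)%N].

Definition graded_module (S : nzRingType) (S_ : nat -> {pred S})
    (M : lmodType S) (M_ : int -> {pred M}) : Prop :=
  [/\ forall n, zmod_closed (M_ n),
      direct_sum M_
    & forall i n a u, a \in S_ i -> u \in M_ n -> a *: u \in M_ (i%:Z + n)].

Record gmod (S : nzRingType) (S_ : nat -> {pred S}) := Gmod {
  gmod_car :> lmodType S;
  gpiece : int -> {pred gmod_car};
  gmodP : graded_module S_ gpiece
}.

Arguments gpiece {S S_} g n.

(** The ideal [A_+], the direct sum of the pieces of positive degree. *)
Definition in_irrelevant (k : fieldType) (A : comAlgType k)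
    (A_ : nat -> {pred A}) (a : A) : Prop :=
  exists (s : seq nat) (f : nat -> A),
    [/\ 0%N \notin s, forall i, f i \in A_ i & a = \sum_(i <- s) f i].

Definition isolated_singularity (k : fieldType) (A : comAlgType k)
    (A_ : nat -> {pred A}) : Prop :=
  forall P : {pred A}, prime_ideal P ->
    ~ (forall a, a \in P <-> in_irrelevant A_ a) -> regular_at P.

(** ** The polynomial subring

    [R] is the image of [poly_eval x : {mpoly k[d]} -> A], where the [x i] are
    homogeneous and algebraically independent; an [R]-module is a module over
    [{mpoly k[d]}], graded by [R_n = R \cap A_n]. *)

Definition poly_eval (k : fieldType) (A : comAlgType k) (d : nat)
    (x : 'I_d -> A) (p : {mpoly k[d]}) : A := mmap (in_alg A) x p.

Definition fin_gen_algebra (k : fieldType) (A : comAlgType k) : Prop :=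
  exists (n : nat) (y : 'I_n -> A), forall a, exists p, a = poly_eval y p.

Definition graded_poly_subring (k : fieldType) (A : comAlgType k)
    (A_ : nat -> {pred A}) (d : nat) (x : 'I_d -> A) : Prop :=
  (forall i, exists n, x i \in A_ n) /\ injective (poly_eval x).

Definition module_finite (k : fieldType) (A : comAlgType k)
    (d : nat) (x : 'I_d -> A) : Prop :=
  exists s : seq A, forall a, exists c : 'I_(size s) -> {mpoly k[d]},
    a = \sum_(i < size s) poly_eval x (c i) * s`_i.

Definition poly_grading (k : fieldType) (A : comAlgType k)
    (A_ : nat -> {pred A}) (d : nat) (x : 'I_d -> A) (n : nat) : {pred {mpoly k[d]}} :=
  [pred p | poly_eval x p \in A_ n].

(** ** Graded modules *)

(* There is a basis [E] consisting of homogeneous elements. *)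
Definition graded_free (S : nzRingType) (S_ : nat -> {pred S}) (V : gmod S_) : Prop :=
  exists E : {pred V},
  [/\ forall e, e \in E -> exists n, e \in gpiece V n,
      forall (s : seq V) (c : V -> S), uniq s -> {subset s <= E} ->
        \sum_(e <- s) c e *: e = 0 -> forall e, e \in s -> c e = 0
    & forall v, exists (s : seq V) (c : V -> S),
        {subset s <= E} /\ v = \sum_(e <- s) c e *: e].

Definition graded_iso (S : nzRingType) (S_ : nat -> {pred S}) (M N : gmod S_) : Prop :=
  exists f : {linear M -> N},
    bijective f /\ forall n u, (f u \in gpiece N n) = (u \in gpiece M n).

(* [M] is isomorphic to [V] as a graded [R]-module, [R] acting on [M] through
   [poly_eval x]. *)
Definition has_type (k : fieldType) (A : comAlgType k) (A_ : nat -> {pred A})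
    (d : nat) (x : 'I_d -> A) (V : gmod (poly_grading A_ x)) (M : gmod A_) : Prop :=
  exists f : V -> M,
  [/\ forall p u v, f (p *: u + v) = poly_eval x p *: f u + f v,
      bijective f
    & forall n u, (f u \in gpiece M n) = (u \in gpiece V n)].

(* Every extension 0 -> M -> E -> M -> 0 of (ungraded) modules splits. *)
Definition rigid (S : nzRingType) (M : lmodType S) : Prop :=
  forall (E : lmodType S) (i : {linear M -> E}) (p : {linear E -> M}),
    injective i -> (forall u, exists e, p e = u) ->
    (forall e, p e = 0 <-> exists u, e = i u) ->
    exists t : {linear M -> E}, forall u, p (t u) = u.

(* Main.v *)
Require Import Defs.
From mathcomp Require Import all_boot all_order all_algebra.
From mathcomp Require Import mpoly.
From HB Require Import structures.
From Stdlib Require Import ClassicalEpsilon.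

Set Implicit Arguments.
Unset Strict Implicit.
Unset Printing Implicit Defensive.

Import Order.TTheory GRing.Theory Num.Theory.
Local Open Scope ring_scope.

(** Fix the graded [R]-module [V], [R] being the polynomial ring.  A graded
    [A]-module of type [V] is an action [rho] of [A] on [V], and for two such
    actions there is a complex [L0 -d0-> L1 -d1-> L2] of finite-dimensional spaces,
    the degree-zero part of the relative bar complex: [Li] consists of the maps
    [A^i * V -> V] that are [R]-linear in each variable and of degree zero,
    [d0 g = rho_N g - g rho_M], and [d1] expresses the cocycle condition.  The
    kernel of [d0] is the space of homomorphisms from [M] to [N], and [d1] kills
    exactly the cocycles [theta] for which [M * M] carries the twisted action
    [a (u, v) = (a u + theta(a, v), a v)], when [M = N].  Hence a rigid [M] makes
    the complex at [(M, M)] exact in the middle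
    ([rigid_cobounds], [degree_zero_cochain]).

    Exactness is an open condition, and the dimension of the kernel of [d0] is
    constant near a point where it holds, so the identity of [M] deforms to a
    homomorphism from [M] to every nearby [N], still invertible.  Spelled out
    with determinants, there is a function [K] with [K M M <> 0], such that
    [K M N <> 0] provides an isomorphism from [M] to [N], and which is a
    polynomial in quantities depending on [M] alone and quantities depending on
    [N] alone.  Such a [K] is a finite sum [sum_j a_j(M) b_j(N)].  Choose finitely
    many [M_i] whose vectors [a(M_i)] span all vectors [a(M)]; every [K M _] is a
    combination of the [K M_i _], so [K M M <> 0] forces [K M_i M <> 0] for some
    [i], and the [M_i] represent all isomorphism classes
    ([finitely_many_kernel_classes], [rigid_actions_finite]).

    The spaces [Li] are finite dimensional because [A] and [V] are generated by
    finitely many homogeneous elements over [R], and the graded pieces of [V] are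
    finite dimensional, the variables of [R] having positive degree
    ([multilinear_bases], [V_finite_dim]). *)

Lemma choice_fun (T U : Type) (R : T -> U -> Prop) :
  (forall t, exists u, R t u) -> exists f, forall t, R t (f t).
Proof.
move=> H.
exists (fun t => proj1_sig (constructive_indefinite_description _ (H t))).
by move=> t; case: (constructive_indefinite_description _ _).
Qed.

(** * Finite bases of spaces of functions *)

Section FunctionBases.

Variables (k : fieldType) (S : nzRingType) (iota : {rmorphism k -> S}).
Variables (T : Type) (U : lmodType S).

Definition lincomb n (b : 'I_n -> T -> U) (c : 'rV[k]_n) (t : T) : U :=
  \sum_i iota (c 0 i) *: b i t.

Definition independent n (b : 'I_n -> T -> U) :=
  forall c, (forall t, lincomb b c t = 0) -> c = 0.

Definition function_basis (P : (T -> U) -> Prop) n (b : 'I_n -> T -> U) :=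
  [/\ forall i, P (b i), independent b &
      forall f, P f -> exists c, forall t, f t = lincomb b c t].

Lemma lincombD n (b : 'I_n -> T -> U) c c' t :
  lincomb b (c + c') t = lincomb b c t + lincomb b c' t.
Proof.
rewrite /lincomb -big_split; apply: eq_bigr => i _ /=.
by rewrite mxE rmorphD scalerDl.
Qed.

Lemma lincombZ n (b : 'I_n -> T -> U) a c t :
  lincomb b (a *: c) t = iota a *: lincomb b c t.
Proof.
rewrite /lincomb scaler_sumr; apply: eq_bigr => i _ /=.
by rewrite mxE rmorphM scalerA.
Qed.

Lemma lincomb_sum I (r : seq I) n (b : 'I_n -> T -> U) (c : I -> 'rV_n) t :
  lincomb b (\sum_(i <- r) c i) t = \sum_(i <- r) lincomb b (c i) t.
Proof.
elim: r => [|i r IH]; last by rewrite !big_cons lincombD IH.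
by rewrite !big_nil /lincomb big1 // => i _; rewrite mxE rmorph0 scale0r.
Qed.

Lemma lincomb_inj n (b : 'I_n -> T -> U) c c' :
  independent b -> (forall t, lincomb b c t = lincomb b c' t) -> c = c'.
Proof.
move=> indb E; apply/eqP; rewrite -subr_eq0; apply/eqP/indb => t.
by rewrite -scaleN1r lincombD lincombZ E rmorphN1 scaleN1r subrr.
Qed.

Lemma lincomb_mulmx p n (b : 'I_n -> T -> U) (c : 'rV_p) (B : 'M_(p, n)) t :
  lincomb b (c *m B) t = \sum_i iota (c 0 i) *: lincomb b (row i B) t.
Proof.
by rewrite mulmx_sum_row lincomb_sum; apply: eq_bigr => i _; rewrite lincombZ.
Qed.

Definition extend_family n (b : 'I_n -> T -> U) f (i : 'I_n.+1) :=
  if unlift ord0 i is Some j then b j else f.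

Lemma lincomb_extend n (b : 'I_n -> T -> U) f (c : 'rV_n.+1) t :
  lincomb (extend_family b f) c t =
  iota (c 0 0) *: f t + lincomb b (\row_j c 0 (lift ord0 j)) t.
Proof.
rewrite /lincomb big_ord_recl /extend_family unlift_none; congr (_ + _).
by apply: eq_bigr => i _; rewrite liftK mxE.
Qed.

(** If the coefficient of [f] in a relation is nonzero, [f] is a combination of
    the other functions; otherwise the relation is one among these. *)
Lemma independent_extend n (b : 'I_n -> T -> U) f :
  independent b -> (forall c, ~ forall t, f t = lincomb b c t) ->
  independent (extend_family b f).
Proof.
move=> indb nf c; pose c' := \row_j c 0 (lift ord0 j).
move=> c0; have [z0|nz0] := eqVneq (c 0 0) 0.
  have: c' = 0.
    apply: indb => t.
    by have := c0 t; rewrite lincomb_extend z0 rmorph0 scale0r add0r.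
  move=> /rowP c'0; apply/rowP => i.
  case: (unliftP ord0 i) => [j ->|->]; last by rewrite z0 mxE.
  by have := c'0 j; rewrite !mxE.
case: (nf ((- (c 0 0)^-1) *: c')) => t.
have := c0 t; rewrite lincomb_extend -/c' => /eqP; rewrite addr_eq0 => /eqP E.
rewrite lincombZ rmorphN scaleNr -scalerN -E scalerA -rmorphM mulVf //.
by rewrite rmorph1 scale1r.
Qed.

(** A maximal independent family spans.  The coordinate vectors [C f] bound the
    size of independent families; [C] is any function, for instance a choice of
    coefficients on a spanning family, and need not be linear. *)
Lemma function_basis_exists (P : (T -> U) -> Prop) m (C : (T -> U) -> 'rV[k]_m) :
  (forall n (b : 'I_n -> T -> U) (c : 'rV_n), (forall i, P (b i)) ->
     \sum_i c 0 i *: C (b i) = 0 -> forall t, lincomb b c t = 0) ->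
  exists n (b : 'I_n -> T -> U), function_basis P b.
Proof.
move=> HC.
have bound n (b : 'I_n -> T -> U) :
    (forall i, P (b i)) -> independent b -> (n <= m)%N.
  move=> Pb indb; pose B := \matrix_i C (b i).
  suff /eqP <- : row_free B by exact: rank_leq_col.
  rewrite -kermx_eq0; apply/eqP/row_matrixP => i; rewrite row0.
  apply: indb; apply: HC => //.
  have /sub_kermxP := row_sub i (kermx B).
  by rewrite mulmx_sum_row; under eq_bigr do rewrite rowK.
have extend n (b : 'I_n -> T -> U) : (forall i, P (b i)) -> independent b ->
    function_basis P b \/ exists b' : 'I_n.+1 -> T -> U,
      (forall i, P (b' i)) /\ independent b'.
  move=> Pb indb.
  have [span|] := classic (forall f, P f -> exists c, forall t, f t = lincomb b c t).
    by left.
  move=> /not_all_ex_not[f nPf]; right; exists (extend_family b f).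
  split; last by apply: independent_extend => // c fc; apply: nPf => _; exists c.
  rewrite /extend_family => i; case: (unlift _ _) => //.
  by apply: NNPP => nf; apply: nPf => /nf.
suff H j n (b : 'I_n -> T -> U) : (m - n <= j)%N -> (forall i, P (b i)) ->
    independent b -> exists n (b : 'I_n -> T -> U), function_basis P b.
  apply: (H m 0 (fun _ _ => 0)) => [||c _]; rewrite ?leq_subr //; first by case.
  by apply/rowP => -[].
elim: j n b => [|j IH] n b mn Pb indb;
  have [basis_b|[b' [Pb' indb']]] := extend n b Pb indb; try by exists n, b.
  by have := bound _ _ Pb' indb'; rewrite ltnNge -subn_eq0 -leqn0 mn.
apply: (IH _ b') => //.
by rewrite subnS; case: (m - n)%N mn.
Qed.

End FunctionBases.

(** * Kernels of finite rank *)

Section FiniteRank.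

Variables (k : fieldType) (X : Type).
Implicit Types K L : X -> X -> k.

(** Sums of products of a function of the first point and a function of the
    second. *)
Definition finite_rank K := exists (I : finType) (a b : X -> I -> k),
  forall M N, K M N = \sum_i a M i * b N i.

Lemma finite_rank_ext K L : (forall M N, K M N = L M N) ->
  finite_rank L -> finite_rank K.
Proof. by move=> E [I [a [b H]]]; exists I, a, b => M N; rewrite E. Qed.

Lemma finite_rank_left (f : X -> k) : finite_rank (fun M _ => f M).
Proof.
exists unit, (fun M _ => f M), (fun _ _ => 1) => M N.
by rewrite (bigD1 tt) //= big1 ?addr0 ?mulr1 // => -[].
Qed.

Lemma finite_rank_right (f : X -> k) : finite_rank (fun _ N => f N).
Proof.
exists unit, (fun _ _ => 1), (fun N _ => f N) => M N.
by rewrite (bigD1 tt) //= big1 ?addr0 ?mul1r // => -[].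
Qed.

Lemma finite_rankD K L :
  finite_rank K -> finite_rank L -> finite_rank (fun M N => K M N + L M N).
Proof.
move=> [I [a [b HK]]] [J [a' [b' HL]]].
exists (I + J)%type,
  (fun M s => match s with inl i => a M i | inr j => a' M j end),
  (fun N s => match s with inl i => b N i | inr j => b' N j end) => M N.
by rewrite HK HL big_sumType.
Qed.

Lemma finite_rankM K L :
  finite_rank K -> finite_rank L -> finite_rank (fun M N => K M N * L M N).
Proof.
move=> [I [a [b HK]]] [J [a' [b' HL]]].
exists (I * J)%type, (fun M s => a M s.1 * a' M s.2),
  (fun N s => b N s.1 * b' N s.2) => M N.
rewrite HK HL big_distrlr /=.
rewrite (pair_bigA _ (fun i j => a M i * b N i * (a' M j * b' N j))) /=.
by apply: eq_bigr => i _; rewrite mulrACA.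
Qed.

Lemma finite_rank_sum J (r : seq J) (K : J -> X -> X -> k) :
  (forall j, finite_rank (K j)) ->
  finite_rank (fun M N => \sum_(j <- r) K j M N).
Proof.
move=> HK; elim: r => [|j r IH].
  by apply: finite_rank_ext (finite_rank_left (fun=> 0)) => M N; rewrite big_nil.
by apply: finite_rank_ext (finite_rankD (HK j) IH) => M N; rewrite big_cons.
Qed.

Lemma finite_rank_prod J (r : seq J) (K : J -> X -> X -> k) :
  (forall j, finite_rank (K j)) ->
  finite_rank (fun M N => \prod_(j <- r) K j M N).
Proof.
move=> HK; elim: r => [|j r IH].
  by apply: finite_rank_ext (finite_rank_left (fun=> 1)) => M N; rewrite big_nil.
by apply: finite_rank_ext (finite_rankM (HK j) IH) => M N; rewrite big_cons.
Qed.

Definition finite_rank_mx m n (B : X -> X -> 'M[k]_(m, n)) :=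
  forall i j, finite_rank (fun M N => B M N i j).

Lemma finite_rank_mx_left m n (B : X -> 'M[k]_(m, n)) :
  finite_rank_mx (fun M _ => B M).
Proof. by move=> i j; apply: finite_rank_left. Qed.

Lemma finite_rank_mx_right m n (B : X -> 'M[k]_(m, n)) :
  finite_rank_mx (fun _ N => B N).
Proof. by move=> i j; apply: finite_rank_right. Qed.

Lemma finite_rank_mxD m n (B C : X -> X -> 'M[k]_(m, n)) :
  finite_rank_mx B -> finite_rank_mx C ->
  finite_rank_mx (fun M N => B M N + C M N).
Proof.
move=> HB HC i j; apply: finite_rank_ext (finite_rankD (HB i j) (HC i j)).
by move=> M N; rewrite mxE.
Qed.

Lemma finite_rank_mxM m n p (B : X -> X -> 'M[k]_(m, n))
    (C : X -> X -> 'M[k]_(n, p)) :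
  finite_rank_mx B -> finite_rank_mx C ->
  finite_rank_mx (fun M N => B M N *m C M N).
Proof.
move=> HB HC i j; have H l := finite_rankM (HB i l) (HC l j).
apply: finite_rank_ext (finite_rank_sum (index_enum _) H).
by move=> M N; rewrite mxE.
Qed.

Lemma finite_rank_mxZ m n K (B : X -> X -> 'M[k]_(m, n)) :
  finite_rank K -> finite_rank_mx B ->
  finite_rank_mx (fun M N => K M N *: B M N).
Proof.
move=> HK HB i j; apply: finite_rank_ext (finite_rankM HK (HB i j)).
by move=> M N; rewrite mxE.
Qed.

Lemma finite_rank_mx_sum J (r : seq J) m n (B : J -> X -> X -> 'M[k]_(m, n)) :
  (forall j, finite_rank_mx (B j)) ->
  finite_rank_mx (fun M N => \sum_(j <- r) B j M N).
Proof.
move=> H i j.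
apply: finite_rank_ext (finite_rank_sum r (fun l => H l i j)) => M N.
by rewrite summxE.
Qed.

Lemma finite_rank_det n (B : X -> X -> 'M[k]_n) :
  finite_rank_mx B -> finite_rank (fun M N => \det (B M N)).
Proof.
move=> HB; apply: finite_rank_sum => s; apply: finite_rankM.
  exact: finite_rank_left (fun=> _).
by apply: finite_rank_prod => i; apply: HB.
Qed.

Lemma finite_rank_adj n (B : X -> X -> 'M[k]_n) :
  finite_rank_mx B -> finite_rank_mx (fun M N => \adj (B M N)).
Proof.
move=> HB i j.
apply: (@finite_rank_ext _ (fun M N => cofactor (B M N) j i)) => [M N|].
  by rewrite mxE.
apply: finite_rankM; first exact: finite_rank_left (fun=> _).
apply: finite_rank_det => p q; rewrite /row' /col'.
by apply: finite_rank_ext (HB (lift j p) (lift i q)) => M N; rewrite !mxE.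
Qed.

(** If [K M N = sum_j a_j(M) b_j(N)], choose the [F i] such that the vectors
    [a (F i)] span all the [a M]: then [K M _] is a linear combination of the
    functions [K (F i) _], and at the point [M] one of them is nonzero. *)
Lemma finite_rank_cover K : finite_rank K -> (forall M, K M M != 0) ->
  exists n (F : 'I_n -> X), forall M, exists i, K (F i) M != 0.
Proof.
move=> [I [a [b HK]]] K1; pose P (f : I -> k) := exists M, f = a M.
pose C (f : I -> k) : 'rV[k]_#|I| := \row_i f (enum_val i).
have [|n [g [Pg _ span]]] :=
    @function_basis_exists k k idfun I k^o P _ C.
  move=> n g c _ /rowP E i; have := E (enum_rank i).
  rewrite summxE mxE => E0; rewrite /lincomb -[RHS]E0; apply: eq_bigr => j _.
  by rewrite !mxE enum_rankK.
have [F HF] := choice_fun Pg.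
exists n, F => M.
have [c Hc] := span (a M) (ex_intro _ M erefl).
apply: NNPP => H; have {}H i : K (F i) M = 0.
  by apply/eqP/negPn/negP => Hi; apply: H; exists i.
have /eqP[] := K1 M; rewrite HK.
under eq_bigr => j _ do rewrite Hc /lincomb mulr_suml.
rewrite exchange_big big1 //= => i _.
under eq_bigr => j _ do rewrite -[_ *: _]/(_ * _) -mulrA HF.
by rewrite -mulr_sumr -HK H mulr0.
Qed.

(** Consider complexes [k^n0 -d0-> k^n1 -d1-> k^n2] of row vectors, depending on
    a pair of points.  If the complex at [(M, M)] is exact in the middle, it has
    a partial homotopy [d1 *m s1 + s0 *m d0 = 1], depending on [M] alone.  At
    [(M, N)] put [phi := d1 *m s1 + s0 *m d0]; where [phi] is invertible it
    preserves the image of [d0], and [w := u - u *m d0 *m phi^-1 *m s0] lies in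
    the kernel of [d0].  After multiplication by [\det phi] everything becomes
    polynomial in functions of [M] and functions of [N], hence of finite rank,
    and on the diagonal [phi = 1] and [w = u]. *)
Lemma finitely_many_kernel_classes n0 n1 n2 m
    (P0 Q0 : X -> 'M[k]_(n0, n1)) (P1 Q1 : X -> 'M[k]_(n1, n2))
    (u : 'rV_n0) (G : 'I_n0 -> 'M[k]_m) :
  (forall M N, (P0 N + Q0 M) *m (P1 N + Q1 M) = 0) ->
  (forall M (v : 'rV_n1), v *m (P1 M + Q1 M) = 0 ->
     exists w, v = w *m (P0 M + Q0 M)) ->
  (forall M, u *m (P0 M + Q0 M) = 0) ->
  \det (\sum_j u 0 j *: G j) != 0 ->
  exists n (F : 'I_n -> X), forall M, exists i (w : 'rV_n0),
    w *m (P0 M + Q0 (F i)) = 0 /\ \det (\sum_j w 0 j *: G j) != 0.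
Proof.
move=> d01 exact_d u_d0 det_u.
pose d0 M N := P0 N + Q0 M; pose d1 M N := P1 N + Q1 M.
pose s1 M := pinvmx (d1 M M).
pose s0 M := (1%:M - d1 M M *m s1 M) *m pinvmx (d0 M M).
pose phi M N := d1 M N *m s1 M + s0 M *m d0 M N.
have phi1 M : phi M M = 1%:M.
  set B := 1%:M - d1 M M *m s1 M.
  have B0 : B *m d1 M M = 0.
    by rewrite mulmxBl mul1mx /s1 mulmxKpV ?subrr.
  have B_d0 : (B <= d0 M M)%MS.
    apply/row_subP => i; have [|v ->] := exact_d M (row i B).
      by rewrite -row_mul B0 row0.
    exact: submxMl.
  have -> : phi M M = d1 M M *m s1 M + B by congr (_ + _); rewrite /s0 mulmxKpV.
  by rewrite addrC subrK.
pose w M N := \det (phi M N) *: u + u *m d0 M N *m \adj (phi M N) *m (- s0 M).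
have w1 M : w M M = u.
  by rewrite /w /d0 u_d0 !mul0mx addr0 phi1 det1 scale1r.
pose K M N := \det (phi M N) * \det (\sum_j w M N 0 j *: G j).
have rk_d0 : finite_rank_mx d0.
  by apply: finite_rank_mxD; [exact: finite_rank_mx_right|exact: finite_rank_mx_left].
have rk_phi : finite_rank_mx phi.
  apply: finite_rank_mxD; apply: finite_rank_mxM => //.
  - by apply: finite_rank_mxD; [exact: finite_rank_mx_right|exact: finite_rank_mx_left].
  - exact: finite_rank_mx_left.
  - exact: finite_rank_mx_left.
have rk_w : finite_rank_mx w.
  apply: finite_rank_mxD.
    apply: finite_rank_mxZ; first exact: finite_rank_det.
    exact: finite_rank_mx_left (fun=> u).
  apply: finite_rank_mxM; last exact: finite_rank_mx_left (fun M => - s0 M).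
  apply: finite_rank_mxM; last exact: finite_rank_adj.
  by apply: finite_rank_mxM => //; exact: finite_rank_mx_left (fun=> u).
have rk_K : finite_rank K.
  apply: finite_rankM; first exact: finite_rank_det.
  apply: finite_rank_det; apply: finite_rank_mx_sum => j.
  apply: finite_rank_mxZ; first exact: rk_w.
  exact: finite_rank_mx_left (fun=> G j).
have [M|n [F HF]] := finite_rank_cover rk_K.
  by rewrite /K w1 phi1 det1 mul1r.
exists n, F => M; have [i] := HF M; rewrite /K mulf_eq0 negb_or => /andP[].
set L := F i => det_phi det_w; exists i, (w L M); split=> //.
rewrite -/L -/(d0 L M).
have phiU : phi L M \in unitmx by rewrite unitmxE unitfE.
have d0_phi : d0 L M *m phi L M = d0 L M *m s0 L *m d0 L M.
  by rewrite /phi mulmxDr mulmxA d01 mul0mx add0r mulmxA.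
(* The automorphism [phi] maps the image of [d0] into itself, hence onto itself;
   so [d0 *m phi^-1] factors through [d0] and is killed by [d1]. *)
have /submxP[B HB] : (d0 L M <= d0 L M *m phi L M)%MS.
  have sub : (d0 L M *m phi L M <= d0 L M)%MS by rewrite d0_phi submxMl.
  rewrite -(mxrank_leqif_sup sub).
  by rewrite mxrankMfree // row_free_unit.
have d0_adj_d1 : d0 L M *m \adj (phi L M) *m d1 L M = 0.
  rewrite HB -(mulmxA B) -(mulmxA (d0 L M)) mul_mx_adj mul_mx_scalar.
  by rewrite -mulmxA -scalemxAl d01 scaler0 mulmx0.
have s0d0 : s0 L *m d0 L M = phi L M - d1 L M *m s1 L.
  by rewrite /phi addrAC subrr add0r.
have E : u *m d0 L M *m \adj (phi L M) *m s0 L *m d0 L M =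
    \det (phi L M) *: (u *m d0 L M).
  have u_adj_d1 : u *m d0 L M *m \adj (phi L M) *m d1 L M = 0.
    by rewrite -!mulmxA (mulmxA (d0 L M)) d0_adj_d1 mulmx0.
  rewrite -[LHS]mulmxA s0d0 mulmxBr -(mulmxA (u *m _)) mul_adj_mx mul_mx_scalar.
  by rewrite mulmxA u_adj_d1 mul0mx subr0.
by rewrite /w mulmxDl mulmxN mulNmx E -scalemxAl subrr.
Qed.

End FiniteRank.

Lemma additive_map0 (U W : zmodType) (f : U -> W) :
  (forall u v, f (u + v) = f u + f v) -> f 0 = 0.
Proof. by move=> fD; apply: (addrI (f 0)); rewrite -fD !addr0. Qed.

Lemma additive_mapN (U W : zmodType) (f : U -> W) u :
  (forall u v, f (u + v) = f u + f v) -> f (- u) = - f u.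
Proof.
by move=> fD; apply/eqP; rewrite -addr_eq0 -fD addNr (additive_map0 fD).
Qed.

(** * Direct sums *)

Section DirectSum.

Variables (I : eqType) (U : zmodType) (U_ : I -> {pred U}).
Hypothesis U_closed : forall i, zmod_closed (U_ i).
Hypothesis U_sum : direct_sum U_.

Lemma piece0 i : 0 \in U_ i.
Proof. by case: (U_closed i). Qed.

Lemma pieceN i u : u \in U_ i -> - u \in U_ i.
Proof. by move=> ui; have [U0 UB] := U_closed i; rewrite -sub0r; apply: UB. Qed.

Lemma pieceD i u v : u \in U_ i -> v \in U_ i -> u + v \in U_ i.
Proof.
by move=> ui /pieceN vi; have [U0 UB] := U_closed i; rewrite -[v]opprK; apply: UB.
Qed.

Lemma homogeneous_decomposition u : exists l : seq (I * U),
  (forall t, t \in l -> t.2 \in U_ t.1) /\ u = \sum_(t <- l) t.2.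
Proof.
have [s [f [fP ->]]] := U_sum.1 u.
exists [seq (i, f i) | i <- s]; rewrite big_map; split=> // t.
by case/mapP=> i _ ->; apply: fP.
Qed.

Lemma homogeneous_ind (P : U -> Prop) :
  P 0 -> (forall u v, P u -> P v -> P (u + v)) ->
  (forall i u, u \in U_ i -> P u) -> forall u, P u.
Proof.
move=> P0 PD Pi u; have [s [f [fP ->]]] := U_sum.1 u.
by elim/big_ind: _ => // i _; apply: Pi (fP i).
Qed.

(** The terms of any given degree add up to zero, and [F] is additive in each
    degree. *)
Lemma homogeneous_sum0 (W : zmodType) (F : I -> U -> W) (l : seq (I * U)) :
  (forall i u v, u \in U_ i -> v \in U_ i -> F i (u + v) = F i u + F i v) ->
  (forall t, t \in l -> t.2 \in U_ t.1) -> \sum_(t <- l) t.2 = 0 ->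
  \sum_(t <- l) F t.1 t.2 = 0.
Proof.
move=> FD lP l0; pose s := undup [seq t.1 | t <- l].
have F0 i : F i 0 = 0.
  by apply: (addrI (F i 0)); rewrite -FD ?addr0 ?piece0.
have part (T : zmodType) (G : I -> U -> T) : \sum_(t <- l) G t.1 t.2 =
    \sum_(i <- s) \sum_(t <- l | t.1 == i) G i t.2.
  under [RHS]eq_bigr => i _ do rewrite big_mkcond.
  rewrite exchange_big; apply: eq_big_seq => t tl /=.
  have ts : t.1 \in s by rewrite mem_undup map_f.
  rewrite (bigD1_seq _ ts) ?undup_uniq //= eqxx big1 ?addr0 // => i.
  by rewrite eq_sym => /negPf ->.
pose f i := \sum_(t <- l | t.1 == i) t.2.
have fF i : f i \in U_ i /\ \sum_(t <- l | t.1 == i) F i t.2 = F i (f i).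
  rewrite /f big_seq_cond [X in X = _]big_seq_cond.
  elim/big_rec2: _ => [|t y u /andP[tl /eqP <-] [ui ->]].
    by rewrite F0 piece0.
  by rewrite FD ?pieceD ?lP.
have f0 i : i \in s -> f i = 0.
  apply: (U_sum.2 s f (undup_uniq _) (fun i => (fF i).1)).
  by rewrite -(part _ (fun _ => id)).
rewrite part big_seq big1 // => i si.
by rewrite (fF i).2 f0 // F0.
Qed.

(** The universal property of the direct sum. *)
Lemma direct_sum_extension (W : zmodType) (F : I -> U -> W) :
  (forall i u v, u \in U_ i -> v \in U_ i -> F i (u + v) = F i u + F i v) ->
  exists f : U -> W, (forall u v, f (u + v) = f u + f v) /\
                     forall i u, u \in U_ i -> f u = F i u.
Proof.
move=> FD; have [L HL] := choice_fun homogeneous_decomposition.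
pose f u := \sum_(t <- L u) F t.1 t.2.
have FN i u : u \in U_ i -> F i (- u) = - F i u.
  move=> ui; have F0 : F i 0 = 0.
    by apply: (addrI (F i 0)); rewrite -FD ?addr0 ?piece0.
  by apply/eqP; rewrite -addr_eq0 -FD ?pieceN // addNr F0.
have fE (l : seq (I * U)) : (forall t, t \in l -> t.2 \in U_ t.1) ->
    f (\sum_(t <- l) t.2) = \sum_(t <- l) F t.1 t.2.
  move=> lP; set u := \sum_(t <- l) _.
  have [LP uE] := HL u.
  have := @homogeneous_sum0 _ F (l ++ [seq (t.1, - t.2) | t <- L u]) FD.
  rewrite !big_cat !big_map /= sumrN -uE -/u subrr => /(_ _ erefl) H.
  have {}H : \sum_(t <- l) F t.1 t.2 + \sum_(t <- L u) F t.1 (- t.2) = 0.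
    apply: H => t; rewrite mem_cat => /orP[/lP //|/mapP[t' /LP t'P ->]].
    exact: pieceN.
  move: H; rewrite [X in _ + X]big_seq.
  under [X in _ + X]eq_bigr => t /LP tP do rewrite FN //.
  by rewrite -big_seq sumrN => /eqP; rewrite subr_eq0 => /eqP ->.
exists f; split=> [u v|i u ui].
  have [uP uE] := HL u; have [vP vE] := HL v.
  rewrite {1}uE {1}vE -big_cat fE ?big_cat // => t.
  by rewrite mem_cat => /orP[/uP|/vP].
by have := fE [:: (i, u)]; rewrite !big_seq1 /=; apply=> t; rewrite inE => /eqP ->.
Qed.

Lemma direct_sum_projections : exists pr : I -> U -> U,
  [/\ forall n u v, pr n (u + v) = pr n u + pr n v,
      forall n u, pr n u \in U_ n,
      forall n u, u \in U_ n -> pr n u = u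
    & forall m n u, u \in U_ m -> m != n -> pr n u = 0].
Proof.
have H n : exists f : U -> U, (forall u v, f (u + v) = f u + f v) /\
    forall i u, u \in U_ i -> f u = if i == n then u else 0.
  by apply: direct_sum_extension => i u v _ _; case: ifP; rewrite ?addr0.
have [pr prP] := choice_fun H; exists pr.
have pr0 n : pr n 0 = 0 by have [_ /(_ n _ (piece0 n))] := prP n; case: ifP.
split=> [n u v|n u|n u un|m n u um /negPf mn].
- by have [-> _] := prP n.
- have [prD prE] := prP n; move: u; apply: homogeneous_ind => [|u v un vn|i u ui].
  + by rewrite pr0 piece0.
  + by rewrite prD pieceD.
  + by rewrite (prE i u ui); case: eqP => [<-|_]; rewrite ?piece0.
- by have [_ /(_ n u un) ->] := prP n; rewrite eqxx.
- by have [_ /(_ m u um) ->] := prP n; rewrite mn.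
Qed.

End DirectSum.
(** * Rigid actions on a fixed graded module *)

(** In the application [S] is the polynomial ring, [iota] the inclusion of the
    constants, and [e] the inclusion of [S] in [A]. *)
Section Actions.

Variables (k : fieldType) (S : comNzRingType) (iota : {rmorphism k -> S}).
Variables (A : comNzRingType) (e : {rmorphism S -> A}) (A_ : nat -> {pred A}).
Variables (V : lmodType S) (V_ : int -> {pred V}).

Hypothesis V_closed : forall n, 0 \in V_ n /\
  forall c u v, u \in V_ n -> v \in V_ n -> iota c *: u + v \in V_ n.
Hypothesis A_mul :
  forall i j a b, a \in A_ i -> b \in A_ j -> a * b \in A_ (i + j)%N.

Definition graded_endo (g : V -> V) : Prop :=
  (forall p u v, g (p *: u + v) = p *: g u + g v) /\
  forall n v, v \in V_ n -> g v \in V_ n.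

Definition graded_bilinear (theta : A * V -> V) : Prop :=
  [/\ forall p a b v, theta (e p * a + b, v) = p *: theta (a, v) + theta (b, v),
      forall a p u v, theta (a, p *: u + v) = p *: theta (a, u) + theta (a, v)
    & forall i n a v, a \in A_ i -> v \in V_ n -> theta (a, v) \in V_ (i%:Z + n)].

Definition graded_trilinear (eta : A * A * V -> V) : Prop :=
  [/\ forall p a a' b v,
        eta (e p * a + a', b, v) = p *: eta (a, b, v) + eta (a', b, v),
      forall p a b b' v,
        eta (a, e p * b + b', v) = p *: eta (a, b, v) + eta (a, b', v),
      forall a b p u v, eta (a, b, p *: u + v) = p *: eta (a, b, u) + eta (a, b, v)
    & forall i j n a b v, a \in A_ i -> b \in A_ j -> v \in V_ n ->
        eta (a, b, v) \in V_ (i%:Z + (j%:Z + n))].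

(** A graded [A]-module structure on [V] that extends its [S]-module structure. *)
Definition graded_action (rho : A -> V -> V) : Prop :=
  [/\ graded_bilinear (fun t => rho t.1 t.2),
      forall a b v, rho (a * b) v = rho a (rho b v)
    & forall v, rho 1 v = v].

(** The Hochschild 1-cocycle condition, with values in the endomorphisms of [V]. *)
Definition cocycle (rho : A -> V -> V) (theta : A * V -> V) : Prop :=
  forall a b v, rho a (theta (b, v)) + theta (a, rho b v) = theta (a * b, v).

Definition cocycles_are_coboundaries (rho : A -> V -> V) : Prop :=
  forall theta, graded_bilinear theta -> cocycle rho theta ->
  exists g, graded_endo g /\
            forall a v, theta (a, v) = rho a (g v) - g (rho a v).

Lemma linear_lincomb T n (b : 'I_n -> T -> V) c t (f : V -> V) :
  (forall p u v, f (p *: u + v) = p *: f u + f v) ->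
  f (lincomb iota b c t) = \sum_i iota (c 0 i) *: f (b i t).
Proof.
move=> linf; have f0 : f 0 = 0.
  by have := linf (-1) 0 0; rewrite scaler0 addr0 scaleN1r addNr.
rewrite /lincomb; elim/big_rec2: _ => // i y1 y2 _ <-; exact: linf.
Qed.

Lemma lincomb_linear T n (b : 'I_n -> T -> V) c p t t1 t2 :
  (forall i, b i t = p *: b i t1 + b i t2) ->
  lincomb iota b c t = p *: lincomb iota b c t1 + lincomb iota b c t2.
Proof.
move=> E; rewrite /lincomb scaler_sumr -big_split; apply: eq_bigr => i _ /=.
by rewrite E scalerDr !scalerA mulrC.
Qed.

Lemma lincomb_homogeneous T n (b : 'I_n -> T -> V) c t m :
  (forall i, b i t \in V_ m) -> lincomb iota b c t \in V_ m.
Proof.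
move=> H; have [V0 VD] := V_closed m.
by rewrite /lincomb; elim/big_ind: _ => // [u v um|i _]; 
  [rewrite -(scale1r u) -(rmorph1 iota)|rewrite -[_ *: _]addr0]; apply: VD.
Qed.

Lemma graded_endo_lincomb n (b : 'I_n -> V -> V) c :
  (forall i, graded_endo (b i)) -> graded_endo (lincomb iota b c).
Proof.
move=> H; split=> [p u v|m v vm].
  by apply: lincomb_linear => i; have [-> _] := H i.
by apply: lincomb_homogeneous => i; have [_ ->] := H i.
Qed.

Lemma graded_bilinear_lincomb n (b : 'I_n -> A * V -> V) c :
  (forall i, graded_bilinear (b i)) -> graded_bilinear (lincomb iota b c).
Proof.
move=> H; split=> [p a a' v|a p u v|i m a v ai vm].
- by apply: lincomb_linear => i; have [-> _ _] := H i.
- by apply: lincomb_linear => i; have [_ -> _] := H i.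
- by apply: lincomb_homogeneous => j; have [_ _ ->] := H j.
Qed.

Lemma graded_trilinear_lincomb n (b : 'I_n -> A * A * V -> V) c :
  (forall i, graded_trilinear (b i)) -> graded_trilinear (lincomb iota b c).
Proof.
move=> H; split=> [p a a' b' v|p a a' b' v|a a' p u v|i j m a a' v ai aj vm].
- by apply: lincomb_linear => i; have [-> _ _ _] := H i.
- by apply: lincomb_linear => i; have [_ -> _ _] := H i.
- by apply: lincomb_linear => i; have [_ _ -> _] := H i.
- by apply: lincomb_homogeneous => l; have [_ _ _ ->] := H l.
Qed.

Lemma graded_endo_comp g h : graded_endo g -> graded_endo h ->
  graded_endo (fun v => g (h v)).
Proof.
move=> [linG degG] [linH degH]; split=> [p u v|n v vn]; first by rewrite linH linG.
exact/degG/degH.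
Qed.

(** A family in [P] depending on a parameter [M] is recorded by the matrix, a
    function of [M], whose rows are the coordinates of its members. *)
Lemma coordinate_matrix (X T : Type) P n (b : 'I_n -> T -> V) p
    (f : X -> 'I_p -> T -> V) :
  function_basis iota P b -> (forall M i, P (f M i)) ->
  exists B : X -> 'M[k]_(p, n),
    forall M i t, lincomb iota b (row i (B M)) t = f M i t.
Proof.
case=> _ _ span Pf.
have [c Hc] := choice_fun (fun Mi : X * 'I_p => span _ (Pf Mi.1 Mi.2)).
exists (fun M => \matrix_i c (M, i)) => M i t.
by rewrite rowK -(Hc (M, i)).
Qed.

(** The complex of [finitely_many_kernel_classes] is the bar complex of the pair
    [(rho M, rho N)], and [u] is the identity of [V].  The determinant tested is
    that of right composition with [w] on the finite-dimensional algebra of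
    degree-zero endomorphisms: if it is nonzero, [w] has a left inverse, which
    is a right inverse as well because right composition with [w] is
    injective. *)
Lemma rigid_actions_finite (X : Type) (rho : X -> A -> V -> V)
    n0 (b0 : 'I_n0 -> V -> V) n1 (b1 : 'I_n1 -> A * V -> V)
    n2 (b2 : 'I_n2 -> A * A * V -> V) :
  function_basis iota graded_endo b0 ->
  function_basis iota graded_bilinear b1 ->
  function_basis iota graded_trilinear b2 ->
  (forall M, graded_action (rho M)) ->
  (forall M, cocycles_are_coboundaries (rho M)) ->
  exists n (F : 'I_n -> X), forall M, exists i g h,
    [/\ graded_endo g, graded_endo h, cancel g h, cancel h g &
        forall a v, rho M a (g v) = g (rho (F i) a v)].
Proof.
move=> B0 B1 B2 act rig.
have [b0P ind0 span0] := B0; have [b1P ind1 span1] := B1.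
have [b2P ind2 span2] := B2.
have rho_lin M a p u v : rho M a (p *: u + v) = p *: rho M a u + rho M a v.
  by have [[_ H _] _ _] := act M; exact: (H a).
have rho_linl M p a b v : rho M (e p * a + b) v = p *: rho M a v + rho M b v.
  by have [[H _ _] _ _] := act M; exact: (H p a b v).
have rho_deg M i n a v : a \in A_ i -> v \in V_ n -> rho M a v \in V_ (i%:Z + n).
  by have [[_ _ H] _ _] := act M; exact: H.
have rhoM M a b v : rho M (a * b) v = rho M a (rho M b v).
  by have [] := act M.
have rho_sub M a u v : rho M a (u - v) = rho M a u - rho M a v.
  by rewrite -scaleN1r addrC rho_lin scaleN1r addrC.
have VN n v : v \in V_ n -> - v \in V_ n.
  have [V0 VD] := V_closed n.
  by move=> vn; rewrite -scaleN1r -(rmorphN1 iota) -[_ *: _]addr0; apply: VD.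
have VB n u v : u \in V_ n -> v \in V_ n -> u - v \in V_ n.
  have [V0 VD] := V_closed n => un /VN vn.
  by rewrite -(scale1r u) -(rmorph1 iota); apply: VD.
have g0P c : graded_endo (lincomb iota b0 c) by exact: graded_endo_lincomb.
(* The matrices, in the chosen bases, of the four maps whose combinations
   are the differentials of the relative bar complex. *)
have [|P0 HP0] := @coordinate_matrix X _ _ _ _ _
  (fun N i t => rho N t.1 (b0 i t.2)) B1.
  move=> N i; have [lin_b deg_b] := b0P i; split=> /= [p a b v|a p u v|j n a v aj vn].
  - by rewrite rho_linl.
  - by rewrite lin_b rho_lin.
  - exact/rho_deg/deg_b.
have [|Q0 HQ0] := @coordinate_matrix X _ _ _ _ _
  (fun M i t => - b0 i (rho M t.1 t.2)) B1.
  move=> M i; have [lin_b deg_b] := b0P i; split=> /= [p a b v|a p u v|j n a v aj vn].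
  - by rewrite rho_linl lin_b opprD scalerN.
  - by rewrite rho_lin lin_b opprD scalerN.
  - exact/VN/deg_b/rho_deg.
have [|P1 HP1] := @coordinate_matrix X _ _ _ _ _
  (fun N i t => rho N t.1.1 (b1 i (t.1.2, t.2))) B2.
  move=> N i; have [linA linV deg_b] := b1P i.
  split=> /= [p a a' b v|p a b b' v|a b p u v|j l n a b v aj bl vn].
  - by rewrite rho_linl.
  - by rewrite linA rho_lin.
  - by rewrite linV rho_lin.
  - exact/rho_deg/deg_b.
have [|Q1 HQ1] := @coordinate_matrix X _ _ _ _ _
  (fun M i t => b1 i (t.1.1, rho M t.1.2 t.2) - b1 i (t.1.1 * t.1.2, t.2)) B2.
  move=> M i; have [linA linV deg_b] := b1P i.
  split=> /= [p a a' b v|p a b b' v|a b p u v|j l n a b v aj bl vn].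
  - by rewrite mulrDl -mulrA !linA scalerBr opprD addrACA.
  - by rewrite mulrDr mulrCA rho_linl linV linA scalerBr opprD addrACA.
  - by rewrite rho_lin !linV scalerBr opprD addrACA.
  - apply: VB; first exact/deg_b/rho_deg.
    by rewrite addrA -PoszD; apply: deg_b => //; apply: A_mul.
have [|G HG] := @coordinate_matrix _ _ _ _ _ _
  (fun j i v => b0 i (b0 j v)) B0.
  by move=> j i; apply: graded_endo_comp.
have d0E M N c a v : lincomb iota b1 (c *m (P0 N + Q0 M)) (a, v) =
    rho N a (lincomb iota b0 c v) - lincomb iota b0 c (rho M a v).
  rewrite mulmxDr lincombD !lincomb_mulmx (linear_lincomb _ _ _ (rho_lin N a)).
  congr (_ + _); first by apply: eq_bigr => i _; rewrite HP0.
  by rewrite [in RHS]/lincomb -sumrN; apply: eq_bigr => i _; rewrite HQ0 scalerN.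
have d1E M N c a b v : lincomb iota b2 (c *m (P1 N + Q1 M)) (a, b, v) =
    rho N a (lincomb iota b1 c (b, v)) +
    (lincomb iota b1 c (a, rho M b v) - lincomb iota b1 c (a * b, v)).
  rewrite mulmxDr lincombD !lincomb_mulmx (linear_lincomb _ _ _ (rho_lin N a)).
  congr (_ + _); first by apply: eq_bigr => i _; rewrite HP1.
  rewrite [in RHS]/lincomb -sumrN -big_split; apply: eq_bigr => i _.
  by rewrite HQ1 /= scalerBr.
have [u Hu] : exists u, forall v, v = lincomb iota b0 u v by exact: (span0 id).
(* The combination of the [G j] with coefficients [w] is the matrix of right
   composition with the endomorphism of coordinates [w]. *)
have GE (w c : 'rV_n0) v : lincomb iota b0 (c *m (\sum_j w 0 j *: G j)) v =
    lincomb iota b0 c (lincomb iota b0 w v).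
  rewrite lincomb_mulmx; apply: eq_bigr => i _; congr (_ *: _).
  have [lin_b _] := b0P i; rewrite (linear_lincomb _ _ _ lin_b).
  rewrite linear_sum lincomb_sum; apply: eq_bigr => j _.
  by rewrite linearZ lincombZ HG.
have uG : \sum_j u 0 j *: G j = 1%:M.
  apply/row_matrixP => i; rewrite rowE -[row i _]mul1mx; apply: (lincomb_inj ind0) => v.
  by rewrite mul1mx rowE GE -Hu mulmx1.
have [||||n [F HF]] := @finitely_many_kernel_classes k X _ _ _ _ P0 Q0 P1 Q1 u G.
- move=> M N; apply/row_matrixP => i; rewrite row0 rowE mulmxA.
  apply: ind2 => -[[a b] v].
  by rewrite d1E !d0E rho_sub !rhoM opprB !subrKA subrr.
- move=> M v v0; have [|g [gP Hg]] := rig M _ (graded_bilinear_lincomb v b1P).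
    move=> a b t; apply/eqP; rewrite -subr_eq0 -addrA -d1E v0 /lincomb big1 // => i _.
    by rewrite mxE rmorph0 scale0r.
  have [c Hc] := span0 g gP; exists c; apply: (lincomb_inj ind1) => -[a t].
  by rewrite d0E Hg !Hc.
- by move=> M; apply: ind1 => -[a t]; rewrite d0E -!Hu subrr.
- by rewrite uG det1 oner_neq0.
exists n, F => M; have [i [w [w0 /negPf det_w]]] := HF M.
set Gw := \sum_j _ in det_w.
have Gw_unit : Gw \in unitmx by rewrite unitmxE unitfE det_w.
pose g := lincomb iota b0 w; pose h := lincomb iota b0 (u *m invmx Gw).
have hg : cancel g h by move=> v; rewrite /g /h -GE mulmxKV // -Hu.
exists i, g, h; split; [exact: g0P|exact: g0P|exact: hg| |].
- move=> v; have [c Hc] := span0 _ (graded_endo_comp (g0P w) (g0P (u *m invmx Gw))).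
  suff E : c = u by rewrite [LHS]Hc E -Hu.
  apply: (can_inj (mulmxK Gw_unit)); apply: (lincomb_inj ind0) => t.
  by rewrite !GE -Hc -Hu -/h -/g hg.
- move=> a v; apply/eqP; rewrite -subr_eq0 -d0E w0 /lincomb big1 // => j _.
  by rewrite mxE rmorph0 scale0r.
Qed.

(** * Finite-dimensionality of the spaces of multilinear maps *)

(** If the members of [P] are determined by their values at finitely many points,
    of prescribed degrees, then [P] is finite dimensional as soon as the pieces
    of [V] of bounded degree lie in the span of one finite family. *)
Lemma function_basis_of_tests T (Q : finType) (tau : Q -> T) (deg : Q -> int)
    (P : (T -> V) -> Prop) :
  (forall B : int, exists (I : finType) (g : I -> V), forall n v, n <= B ->
     v \in V_ n -> exists c : I -> k, v = \sum_i iota (c i) *: g i) ->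
  (forall f, P f -> forall q, f (tau q) \in V_ (deg q)) ->
  (forall n (b : 'I_n -> T -> V) c, (forall i, P (b i)) ->
     (forall q, lincomb iota b c (tau q) = 0) ->
     forall t, lincomb iota b c t = 0) ->
  exists n (b : 'I_n -> T -> V), function_basis iota P b.
Proof.
move=> fdV degP determined.
have [I [g span_g]] := fdV (\sum_q `|deg q|).
have deg_le q : deg q <= \sum_q `|deg q|.
  rewrite (bigD1 q) //=; apply: le_trans (ler_norm _) _.
  by rewrite lerDl sumr_ge0.
have [C HC] : exists C : (T -> V) * Q -> I -> k, forall fq, P fq.1 ->
    fq.1 (tau fq.2) = \sum_i iota (C fq i) *: g i.
  apply: (choice_fun (R := fun fq c => P fq.1 -> fq.1 (tau fq.2) =
    \sum_i iota (c i) *: g i)) => -[f q] /=.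
  have [Pf|nPf] := classic (P f); last by exists (fun=> 0) => Pf; case: nPf.
  by have [c Hc] := span_g _ _ (deg_le q) (degP f Pf q); exists c.
pose D f : 'rV[k]_#|{: Q * I}| := \row_s C (f, (enum_val s).1) (enum_val s).2.
apply: (@function_basis_exists _ _ _ _ _ P _ D) => n b c Pb D0.
apply: determined => // q; rewrite /lincomb.
under eq_bigr => i _ do rewrite [b i _](HC (b i, q) (Pb i)) scaler_sumr.
rewrite exchange_big big1 //= => i _.
under eq_bigr => j _ do rewrite scalerA -rmorphM.
rewrite -scaler_suml -rmorph_sum.
have /rowP/(_ (enum_rank (q, i))) := D0; rewrite summxE mxE.
under eq_bigr => j _ do rewrite !mxE enum_rankK.
by move=> ->; rewrite rmorph0 scale0r.
Qed.

Lemma linear_vanish (I : finType) (z : I -> V) (f : V -> V) :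
  (forall v, exists c : I -> S, v = \sum_i c i *: z i) ->
  (forall p u v, f (p *: u + v) = p *: f u + f v) ->
  (forall i, f (z i) = 0) -> forall v, f v = 0.
Proof.
move=> gen linf fz v; have [c ->] := gen v.
have f0 : f 0 = 0.
  by have := linf (-1) 0 0; rewrite scaler0 addr0 scaleN1r addNr.
elim/big_ind: _ => [|u w fu fw|i _].
- exact: f0.
- by rewrite -[u]scale1r linf fu fw scaler0 addr0.
- by rewrite -[_ *: z i]addr0 linf fz f0 scaler0 addr0.
Qed.

Lemma linear_vanish_alg (J : finType) (y : J -> A) (f : A -> V) :
  (forall a, exists c : J -> S, a = \sum_j e (c j) * y j) ->
  (forall p a b, f (e p * a + b) = p *: f a + f b) ->
  (forall j, f (y j) = 0) -> forall a, f a = 0.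
Proof.
move=> gen linf fy a; have [c ->] := gen a.
have f0 : f 0 = 0.
  by have := linf (-1) 0 0; rewrite mulr0 addr0 scaleN1r addNr.
elim/big_ind: _ => [//|u w fu fw|j _].
  by rewrite -[u]mul1r -(rmorph1 e) linf fu fw scaler0 addr0.
by rewrite -[_ * y j]addr0 linf fy f0 scaler0 addr0.
Qed.

(** Multilinear maps are determined by their values at tuples of generators. *)
Lemma multilinear_bases (I J : finType) (z : I -> V) (dz : I -> int)
    (y : J -> A) (dy : J -> nat) :
  (forall B : int, exists (I : finType) (g : I -> V), forall n v, n <= B ->
     v \in V_ n -> exists c : I -> k, v = \sum_i iota (c i) *: g i) ->
  (forall v, exists c : I -> S, v = \sum_i c i *: z i) ->
  (forall i, z i \in V_ (dz i)) ->
  (forall a, exists c : J -> S, a = \sum_j e (c j) * y j) ->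
  (forall j, y j \in A_ (dy j)) ->
  [/\ exists n (b : 'I_n -> V -> V), function_basis iota graded_endo b,
      exists n (b : 'I_n -> A * V -> V), function_basis iota graded_bilinear b
    & exists n (b : 'I_n -> A * A * V -> V),
        function_basis iota graded_trilinear b].
Proof.
move=> fdV genz zP geny yP; split.
- apply: (@function_basis_of_tests _ I z dz) => // [g [_ deg_g] i|n b c Pb b0].
    exact: deg_g.
  have [lin_b _] := graded_endo_lincomb c Pb.
  exact: linear_vanish genz lin_b b0.
- apply: (@function_basis_of_tests _ (J * I)%type (fun q => (y q.1, z q.2))
    (fun q => (dy q.1)%:Z + dz q.2)) => // [g [_ _ deg_g] q|n b c Pb b0].
    exact: deg_g.
  have [linA linV _] := graded_bilinear_lincomb c Pb.
  case=> a v; apply: (linear_vanish genz (linV a)) => i.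
  apply: (linear_vanish_alg geny (fun p a b => linA p a b (z i))) => j.
  exact: (b0 (j, i)).
- apply: (@function_basis_of_tests _ (J * J * I)%type
    (fun q => (y q.1.1, y q.1.2, z q.2))
    (fun q => (dy q.1.1)%:Z + ((dy q.1.2)%:Z + dz q.2)))
    => // [g [_ _ _ deg_g] q|n b c Pb b0].
    exact: deg_g.
  have [linA linB linV _] := graded_trilinear_lincomb c Pb.
  case=> [[a a'] v]; apply: (linear_vanish genz (linV a a')) => i.
  apply: (linear_vanish_alg geny (fun p b b' => linB p a b b' (z i))) => j'.
  apply: (linear_vanish_alg geny (fun p a b => linA p a b (y j') (z i))) => j.
  exact: (b0 (j, j', i)).
Qed.

(** A cochain bounding a cocycle need not respect degrees, but if the cocycle has
    degree zero then the degree-zero part of the cochain bounds it too.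
    That part is [S]-linear because the cocycle vanishes on [S]. *)
Lemma degree_zero_cochain rho theta g :
  (forall n, zmod_closed (V_ n)) -> direct_sum V_ -> direct_sum A_ ->
  graded_action rho -> graded_bilinear theta -> cocycle rho theta ->
  (forall u v, g (u + v) = g u + g v) ->
  (forall a v, theta (a, v) = rho a (g v) - g (rho a v)) ->
  exists g0, graded_endo g0 /\
             forall a v, theta (a, v) = rho a (g0 v) - g0 (rho a v).
Proof.
move=> VC VS AS [[rho_linl rho_lin rho_deg] rhoM rho1].
move=> [th_linl th_lin th_deg] th_coc gD thE.
have [pr [prD prP pr_id pr_0]] := direct_sum_projections VC VS.
have [g0 [g0D g0E]] : exists f : V -> V, (forall u v, f (u + v) = f u + f v) /\
    forall n u, u \in V_ n -> f u = pr n (g u).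
  by apply: (direct_sum_extension VC VS) => n u v _ _; rewrite gD prD.
have rhoD a u v : rho a (u + v) = rho a u + rho a v.
  by rewrite -[u]scale1r (rho_lin a) !scale1r.
have rhoDl a b v : rho (a + b) v = rho a v + rho b v.
  by rewrite -[a]mul1r -(rmorph1 e) (rho_linl 1 a b v) rmorph1 mul1r scale1r.
have thD a u v : theta (a, u + v) = theta (a, u) + theta (a, v).
  by rewrite -[u]scale1r th_lin !scale1r.
have thDl a b v : theta (a + b, v) = theta (a, v) + theta (b, v).
  by rewrite -[a]mul1r -(rmorph1 e) th_linl rmorph1 mul1r scale1r.
have pr0 n := additive_map0 (prD n); have g00 := additive_map0 g0D.
have rho0 a := additive_map0 (rhoD a); have th0 a := additive_map0 (thD a).
have rho0l v : rho 0 v = 0 := additive_map0 (fun a b => rhoDl a b v).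
have th0l v : theta (0, v) = 0 := additive_map0 (fun a b => thDl a b v).
(* Projections commute, up to a shift, with the action of homogeneous elements. *)
have pr_rho a i n v : a \in A_ i -> pr (i%:Z + n) (rho a v) = rho a (pr n v).
  move=> ai; move: v; apply: (homogeneous_ind VS) => [|u v IHu IHv|m u um].
  - by rewrite rho0 !pr0 rho0.
  - by rewrite rhoD !prD IHu IHv rhoD.
  - have aum : rho a u \in V_ (i%:Z + m) by exact: rho_deg.
    have [<-|mn] := eqVneq m n; first by rewrite !pr_id.
    rewrite [pr n u](pr_0 m) // (pr_0 (i%:Z + m)) ?rho0 //.
    by apply: contra_neq mn => /addrI.
(* By additivity it suffices to compare both sides on homogeneous [a] and [v],
   where this is the component of [thE] in the degree of [theta (a, v)]. *)
have thE0 a v : theta (a, v) = rho a (g0 v) - g0 (rho a v).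
  move: a; apply: (homogeneous_ind AS) => [|a b IHa IHb|i a ai].
  - by rewrite th0l !rho0l g00 subr0.
  - by rewrite thDl IHa IHb !rhoDl g0D opprD addrACA.
  move: v; apply: (homogeneous_ind VS) => [|u v IHu IHv|n v vn].
  - by rewrite th0 g00 !rho0 g00 subrr.
  - by rewrite thD IHu IHv g0D !rhoD g0D opprD addrACA.
  have avn : rho a v \in V_ (i%:Z + n) by exact: rho_deg.
  rewrite (g0E _ _ vn) (g0E _ _ avn) -(pr_rho a i n) //.
  rewrite -(additive_mapN _ (prD _)) -prD -thE pr_id //; exact: th_deg.
exists g0; split=> //; split=> [p u v|n v vn]; last by rewrite (g0E n) ?prP.
have th1 w : theta (1, w) = 0.
  have := th_coc 1 1 w; rewrite !rho1 mulr1.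
  by rewrite -[X in _ = X]addr0 => /addrI.
have rho_e w : rho (e p) w = p *: w.
  by have := rho_linl p 1 0 w; rewrite /= mulr1 addr0 rho1 rho0l addr0.
have th_e w : theta (e p, w) = 0.
  by have := th_linl p 1 0 w; rewrite mulr1 addr0 th1 th0l scaler0 addr0.
rewrite g0D; congr (_ + _); apply/esym/eqP; rewrite -subr_eq0 -!rho_e.
by rewrite -thE0 th_e.
Qed.

End Actions.
(** * Self-extensions twisted by a cocycle *)

Section TwistedExtension.

Variables (A : nzRingType) (M : lmodType A).

Record twisting_cocycle := Twist {
  twist :> A -> M -> M;
  twistDl : forall a b u, twist (a + b) u = twist a u + twist b u;
  twistD : forall a u v, twist a (u + v) = twist a u + twist a v;
  twistM : forall a b u, twist (a * b) u = a *: twist b u + twist a (b *: u)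
}.

(** The cocycle is an argument only to let the module structure below be
    inferred from the type. *)
Definition twisted (th : twisting_cocycle) : Type := (M * M)%type.

HB.instance Definition _ th := GRing.Zmodule.copy (twisted th) (M * M)%type.

Definition twisted_scale th a (w : twisted th) : twisted th :=
  (a *: w.1 + th a w.2, a *: w.2).

Lemma twisted_scaleA th a b (w : twisted th) :
  twisted_scale a (twisted_scale b w) = twisted_scale (a * b) w.
Proof.
by rewrite /twisted_scale /= twistM scalerDr !scalerA addrA.
Qed.

Lemma twisted_scale1 th : left_id 1 (@twisted_scale th).
Proof.
case=> u v; rewrite /twisted_scale /= !scale1r.
have -> : th 1 v = 0; last by rewrite addr0.
apply: (addrI (th 1 v)); rewrite -{2}(scale1r v) -{1}(scale1r (th 1 v)).
by rewrite -twistM mulr1 addr0.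
Qed.

Lemma twisted_scaleDr th : right_distributive (@twisted_scale th) +%R.
Proof.
move=> a [u v] [u' v']; rewrite /twisted_scale /= !scalerDr twistD.
by congr pair; rewrite addrACA.
Qed.

Lemma twisted_scaleDl th (w : twisted th) :
  {morph @twisted_scale th ^~ w : a b / a + b}.
Proof.
case: w => u v a b; rewrite /twisted_scale /= !scalerDl twistDl.
by congr pair; rewrite addrACA.
Qed.

HB.instance Definition _ th := GRing.Zmodule_isLmodule.Build A (twisted th)
  (@twisted_scaleA th) (@twisted_scale1 th) (@twisted_scaleDr th)
  (@twisted_scaleDl th).

(** The twisted module is a self-extension of [M]; the first component of a
    section, up to sign, is a cochain bounding the cocycle. *)
Lemma rigid_cobounds (th : twisting_cocycle) : rigid M ->
  exists s : M -> M, (forall u v, s (u + v) = s u + s v) /\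
                     forall a u, th a u = a *: s u - s (a *: u).
Proof.
move=> rigM.
have th0 a : th a 0 = 0 by apply: (addrI (th a 0)); rewrite -twistD !addr0.
pose inj (u : M) : twisted th := (u, 0).
pose prj (w : twisted th) : M := w.2.
have inj_lin : linear inj.
  by move=> a u v; rewrite /inj; congr pair; rewrite /= ?th0 ?addr0 ?scaler0.
have prj_lin : linear prj by [].
pose i : {linear M -> twisted th} :=
  HB.pack inj (GRing.isLinear.Build _ _ _ _ inj inj_lin).
pose p : {linear twisted th -> M} :=
  HB.pack prj (GRing.isLinear.Build _ _ _ _ prj prj_lin).
have [||[u v]|t pt] := rigM (twisted th) i p.
- by move=> u v [].
- by move=> u; exists (0, u).
- split=> [/= v0|[u' [_ ->]] //]; exists u.
  by rewrite /i /= /inj; congr pair; exact: v0.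
exists (fun u => - (t u).1); split=> [u v|a u].
  by rewrite linearD /= opprD.
have := congr1 fst (linearZ_LR t a u); rewrite /= {2}/GRing.scale /= => ->.
have -> : (t u).2 = u by exact: pt.
by rewrite scalerN opprK addKr.
Qed.

End TwistedExtension.
(** * Homogeneous generators and finite-dimensional pieces *)

(** The homogeneous components of finitely many generators generate.  Scalars
    act through [act], so that this applies both to modules and to [A] as a
    module over a subring. *)
Lemma homogeneous_generators (I : eqType) (U : zmodType) (U_ : I -> {pred U})
    (T : Type) (act : T -> U -> U) (Q : finType) (w : Q -> U) :
  direct_sum U_ -> (forall p u v, act p (u + v) = act p u + act p v) ->
  (forall u, exists c : Q -> T, u = \sum_q act (c q) (w q)) ->
  exists (J : finType) (z : J -> U) (dz : J -> I), (forall j, z j \in U_ (dz j)) /\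
    forall u, exists c : J -> T, u = \sum_j act (c j) (z j).
Proof.
move=> U_sum actD gen.
have [L HL] := choice_fun (fun q => homogeneous_decomposition U_sum (w q)).
pose z (j : {q : Q & 'I_(size (L q))}) :=
  tnth (in_tuple (L (tag j))) (tagged j).
exists {q : Q & 'I_(size (L q))}, (fun j => (z j).2), (fun j => (z j).1).
split=> [j|u]; first by have [LP _] := HL (tag j); apply: LP; exact: mem_tnth.
have [c ->] := gen u; exists (fun j => c (tag j)).
transitivity (\sum_q \sum_j act (c q) (tnth (in_tuple (L q)) j).2).
  apply: eq_bigr => q _; have [_ {1}->] := HL q; rewrite [in LHS]big_tnth.
  by apply: (big_morph (act (c q))) => //; exact: additive_map0.
by rewrite sig_big_dep.
Qed.

HB.instance Definition _ (k : fieldType) (A : comAlgType k) d (x : 'I_d -> A) :=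
  GRing.RMorphism.copy (poly_eval x) (mmap (in_alg A) x).

Section GradedModules.

Variables (k : closedFieldType) (A : comAlgType k) (A_ : nat -> {pred A}).
Variables (d : nat) (x : 'I_d -> A).
Hypothesis A_graded : graded_algebra A_.
Hypothesis A0_fin :
  exists s : seq A, forall a, a \in A_ 0%N -> spanned s a.
Hypothesis x_poly : graded_poly_subring A_ x.

Lemma A_scale i c a : a \in A_ i -> c *: a \in A_ i.
Proof.
have [/(_ i)[A0 AD] _ _ _] := A_graded => ai.
by rewrite -[_ *: _]addr0; apply: AD.
Qed.

Lemma poly_evalC c : poly_eval x c%:MP = c%:A.
Proof. exact: mmapC. Qed.

(** Since [A_ 0] is finite dimensional, it contains no transcendental element. *)
Lemma degree_x_gt0 i n : x i \in A_ n -> (0 < n)%N.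
Proof.
case: n => // xi0; have [_ inj_x] := x_poly; have [s Hs] := A0_fin.
have [_ _ A1 AM] := A_graded.
have xiX j : x i ^+ j \in A_ 0%N.
  by elim: j => [|j IH]; rewrite ?expr0 // exprS; exact: (AM 0%N 0%N).
have [c Hc] := choice_fun (fun j => Hs _ (xiX j)).
(* More powers of [x i] than generators of [A_ 0]: they satisfy a linear relation
   [r], which contradicts algebraic independence. *)
pose C : 'M[k]_((size s).+1, size s) := \matrix_(j, l) c j l.
have : kermx C != 0.
  rewrite kermx_eq0 /row_free; apply/eqP => rC.
  by have := rank_leq_col C; rewrite rC ltnn.
case/rowV0Pn => r /sub_kermxP rC0; case/rV0Pn => j0 /eqP[].
pose p : {mpoly k[d]} := \sum_(j < (size s).+1) r 0 j *: 'X_i ^+ j.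
have p0 : p = 0.
  apply: inj_x; rewrite rmorph0 rmorph_sum /=.
  under eq_bigr => j _ do
    rewrite -mul_mpolyC rmorphM rmorphXn /= poly_evalC mulr_algl
      /(poly_eval x 'X_i) mmapX mmap1U Hc scaler_sumr.
  rewrite exchange_big big1 //= => l _.
  under eq_bigr => j _ do rewrite scalerA.
  rewrite -scaler_suml; have /rowP/(_ l) := rC0; rewrite !mxE.
  by under eq_bigr => j _ do rewrite mxE; move=> ->; rewrite scale0r.
have := congr1 (mcoeff (U_(i) *+ j0)) p0; rewrite mcoeff0 => <-.
rewrite linear_sum /= (bigD1 j0) //= big1 ?addr0 => [|j jj0].
  by rewrite linearZ /= mpolyXn mcoeffX eqxx mulr1.
rewrite linearZ /= mpolyXn mcoeffX; case: eqP; rewrite ?mulr0 //.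
move=> /mnmP/(_ i); rewrite !mulmnE mnm1E eqxx !mul1n => /val_inj E.
by rewrite E eqxx in jj0.
Qed.

Lemma poly_eval_monomial dx (m : 'X_{1..d}) :
  (forall i, x i \in A_ (dx i)) ->
  poly_eval x 'X_[m] \in A_ (\sum_(i < d) m i * dx i)%N.
Proof.
move=> xP; have [_ _ A1 AM] := A_graded.
rewrite /poly_eval mmapX /mmap1.
elim/big_rec2: _ => [//|i n a _ an]; apply: (AM _ _) => //.
by elim: (m i) => [|j IH]; rewrite ?expr0 ?mul0n // exprS mulSn; apply: AM.
Qed.

Section Pieces.

Variable V : gmod (poly_grading A_ x).

Lemma V_closed n : zmod_closed (gpiece V n).
Proof. by have [H _ _] := gmodP V. Qed.

Lemma V_sum : direct_sum (gpiece V).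
Proof. by have [_ H _] := gmodP V. Qed.

Lemma V_act i n (p : {mpoly k[d]}) v : poly_eval x p \in A_ i ->
  v \in gpiece V n -> p *: v \in gpiece V (i%:Z + n).
Proof. by have [_ _ H] := gmodP V; exact: H. Qed.

Lemma V_scale n (c : k) v : v \in gpiece V n -> c%:MP *: v \in gpiece V n.
Proof.
have [_ _ A1 _] := A_graded; rewrite -{2}[n]add0r; apply: V_act.
by rewrite poly_evalC; exact: A_scale.
Qed.

(** A homogeneous element of degree [n] is a combination of the elements
    ['X_[m] *: z i] of the same degree, and as the variables have positive
    degree only finitely many [m] occur. *)
Lemma V_finite_dim (I : finType) (z : I -> V) (dz : I -> int) :
  (forall i, z i \in gpiece V (dz i)) ->
  (forall v, exists c : I -> {mpoly k[d]}, v = \sum_i c i *: z i) ->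
  forall B : int, exists (J : finType) (g : J -> V), forall n v, n <= B ->
    v \in gpiece V n -> exists c : J -> k, v = \sum_j (c j)%:MP *: g j.
Proof.
move=> zP gen B.
have [x_hom _] := x_poly; have [dx xP] := choice_fun x_hom.
have [pr [prD prP pr_id pr_0]] := direct_sum_projections V_closed V_sum.
pose D := (`|B| + \sum_i `|dz i|).+1%N.
pose g (j : I * 'X_{1..d < D}) : V := 'X_[j.2] *: z j.1.
exists (I * 'X_{1..d < D})%type, g => n v nB vn.
pose spans u := exists c : I * 'X_{1..d < D} -> k, u = \sum_j (c j)%:MP *: g j.
have spans0 : spans 0.
  by exists (fun=> 0); rewrite big1 // => j _; rewrite mpolyC0 scale0r.
have spansD u u' : spans u -> spans u' -> spans (u + u').
  move=> [c ->] [c' ->]; exists (fun j => c j + c' j).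
  by rewrite -big_split; apply: eq_bigr => j _; rewrite mpolyCD scalerDl.
suff H u : spans (pr n u) by rewrite -(pr_id n v vn); exact: H.
have [c ->] := gen u; elim/big_ind: _ => [|u1 u2 H1 H2|i _].
- by rewrite (additive_map0 (prD n)).
- by rewrite prD; apply: spansD.
rewrite (mpolyE (c i)) scaler_suml.
elim/big_ind: _ => [|u1 u2 H1 H2|m _].
- by rewrite (additive_map0 (prD n)).
- by rewrite prD; apply: spansD.
set w := (\sum_(j < d) m j * dx j)%N.
have mz : (c i)@_m *: 'X_[m] *: z i \in gpiece V (w%:Z + dz i).
  apply: V_act => //; rewrite -mul_mpolyC rmorphM /= poly_evalC mulr_algl.
  exact/A_scale/poly_eval_monomial.
have [wn|wn] := eqVneq (w%:Z + dz i) n; last first.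
  by rewrite (pr_0 _ _ _ mz wn).
rewrite pr_id -?wn //.
(* As each [dx j] is positive, [mdeg m <= w = n - dz i <= B - dz i < D]. *)
have mD : (mdeg m < D)%N.
  have mw : (mdeg m <= w)%N.
    rewrite mdegE; apply: leq_sum => j _; rewrite -{1}[m j]muln1 leq_mul2l.
    by rewrite (degree_x_gt0 (xP j)) orbT.
  rewrite ltnS (leq_trans mw) // -lez_nat PoszD.
  have -> : w%:Z = n - dz i by rewrite -wn addrK.
  apply: lerD; first by rewrite (le_trans nB) // abszE ler_norm.
  rewrite (bigD1 i) //= PoszD -[X in X <= _]addr0 lerD // abszE.
  by rewrite -normrN ler_norm.
exists (fun j => if j == (i, BMultinom mD) then (c i)@_m else 0).
rewrite (bigD1 (i, BMultinom mD)) //= big1 ?addr0 ?eqxx => [|j /negPf ->].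
  by rewrite /g /= scalerA mul_mpolyC.
by rewrite mpolyC0 scale0r.
Qed.

(** [V] inherits finite generation over the polynomial ring from any finitely
    generated [A]-module of type [V]. *)
Lemma generators_of_type (M : gmod A_) :
  module_finite x -> (exists s : seq M, forall u, spanned s u) -> has_type V M ->
  exists (I : finType) (z : I -> V) (dz : I -> int),
    (forall i, z i \in gpiece V (dz i)) /\
    forall v, exists c : I -> {mpoly k[d]}, v = \sum_i c i *: z i.
Proof.
move=> [t genA] [s genM] [f [linf [f' fK f'K] _]].
have f'_lin p u v : f' (poly_eval x p *: u + v) = p *: f' u + f' v.
  by apply: (can_inj fK); rewrite linf !f'K.
have f'0 : f' 0 = 0.
  by have := f'_lin (-1) 0 0; rewrite scaler0 addr0 scaleN1r addNr.
apply: (@homogeneous_generators _ _ _ {mpoly k[d]} *:%R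
  ('I_(size s) * 'I_(size t))%type (fun q => f' (t`_q.2 *: s`_q.1)) V_sum).
  by move=> p u v; rewrite scalerDr.
move=> v; have [c vE] := genM (f v); have [b bE] := choice_fun genA.
exists (fun q => b (c q.1) q.2).
rewrite -(pair_bigA _ (fun i j => b (c i) j *: f' (t`_j *: s`_i))) /=.
rewrite -{1}(fK v) vE.
have f'D u w : f' (u + w) = f' u + f' w.
  by rewrite -[u in LHS]scale1r -(rmorph1 (poly_eval x)) f'_lin scale1r.
rewrite (big_morph f' f'D f'0); apply: eq_bigr => i _.
rewrite {1}(bE (c i)) scaler_suml (big_morph f' f'D f'0); apply: eq_bigr => j _.
by rewrite -scalerA -[_ *: (_ *: _)]addr0 f'_lin f'0 addr0.
Qed.

End Pieces.

Lemma generators_of_algebra : module_finite x ->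
  exists (J : finType) (y : J -> A) (dy : J -> nat),
    (forall j, y j \in A_ (dy j)) /\
    forall a, exists c : J -> {mpoly k[d]}, a = \sum_j poly_eval x (c j) * y j.
Proof.
move=> [t genA]; have [_ A_sum _ _] := A_graded.
apply: (@homogeneous_generators _ _ _ {mpoly k[d]} (fun p a => poly_eval x p * a)
  'I_(size t) (fun j => t`_j) A_sum) => // p u v.
by rewrite mulrDr.
Qed.

(** * Modules of a given type as actions on a fixed module *)

Section Marked.

Variable V : gmod (poly_grading A_ x).

(** A rigid module together with an isomorphism from [V]: transporting the
    structure along it turns modules of type [V] into actions on [V]. *)
Record rigid_marking := RigidMarking {
  marked_mod : gmod A_;
  mark : V -> marked_mod;
  unmark : marked_mod -> V;
  mark_linear : forall p u v, mark (p *: u + v) = poly_eval x p *: mark u + mark v;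
  markK : cancel mark unmark;
  unmarkK : cancel unmark mark;
  mark_degree : forall n v, (mark v \in gpiece marked_mod n) = (v \in gpiece V n);
  marked_rigid : rigid marked_mod
}.

Arguments unmark : clear implicits.
Arguments markK : clear implicits.
Arguments unmarkK : clear implicits.
Arguments marked_rigid : clear implicits.

Lemma rigid_markingP (M : gmod A_) : rigid M -> has_type V M ->
  exists P : rigid_marking, marked_mod P = M.
Proof.
move=> rigM [f [linf [f' fK f'K] deg_f]].
by exists (RigidMarking linf fK f'K deg_f rigM).
Qed.

Definition marked_action (P : rigid_marking) (a : A) (v : V) : V :=
  unmark P (a *: mark P v).

Lemma markD (P : rigid_marking) u v : mark P (u + v) = mark P u + mark P v.
Proof. by rewrite -[u]scale1r mark_linear rmorph1 !scale1r. Qed.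

Lemma unmark_linear (P : rigid_marking) p u v :
  unmark P (poly_eval x p *: u + v) = p *: unmark P u + unmark P v.
Proof. by apply: (can_inj (markK P)); rewrite mark_linear !unmarkK. Qed.

Lemma unmarkD (P : rigid_marking) u v :
  unmark P (u + v) = unmark P u + unmark P v.
Proof.
rewrite -[u]scale1r -(rmorph1 (poly_eval x)) unmark_linear.
by rewrite rmorph1 !scale1r.
Qed.

Lemma unmark_degree (P : rigid_marking) n u :
  (unmark P u \in gpiece V n) = (u \in gpiece (marked_mod P) n).
Proof. by rewrite -(mark_degree P) unmarkK. Qed.

Lemma marked_action_graded (P : rigid_marking) :
  graded_action (poly_eval x) A_ (gpiece V) (marked_action P).
Proof.
rewrite /marked_action; split=> [|a b v|v]; last by rewrite scale1r markK.
  split=> /= [p a b v|a p u v|i n a v ai vn].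
  - by rewrite scalerDl -scalerA unmark_linear.
  - by rewrite mark_linear scalerDr scalerA mulrC -scalerA unmark_linear.
  - rewrite unmark_degree; have [_ _ H] := gmodP (marked_mod P).
    by apply: H; rewrite ?mark_degree.
by rewrite unmarkK scalerA.
Qed.

(** A cocycle on [V] is transported to the module, bounded there by rigidity,
    and the resulting cochain is replaced by its degree-zero part. *)
Lemma marked_action_rigid (P : rigid_marking) :
  cocycles_are_coboundaries (poly_eval x) A_ (gpiece V) (marked_action P).
Proof.
move=> theta th_gr coc; have [th_linl th_lin th_deg] := th_gr.
have [_ A_sum _ _] := A_graded.
pose th a u := mark P (theta (a, unmark P u)).
have thDl a b u : th (a + b) u = th a u + th b u.
  by rewrite /th -markD -[a]mul1r -{1}(rmorph1 (poly_eval x)) th_linl scale1r mul1r.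
have thD a u v : th a (u + v) = th a u + th a v.
  by rewrite /th -markD unmarkD -[unmark P u]scale1r th_lin !scale1r.
have thM a b u : th (a * b) u = a *: th b u + th a (b *: u).
  by rewrite /th -coc markD /marked_action !unmarkK.
have [s [sD sE]] := rigid_cobounds (Twist thDl thD thM) (marked_rigid P).
apply: (degree_zero_cochain (e := poly_eval x) (A_ := A_)
  (g := fun v => unmark P (s (mark P v)))) => //.
- exact: V_closed.
- exact: V_sum.
- exact: marked_action_graded.
- by move=> u v; rewrite markD sD unmarkD.
move=> a v; rewrite -[LHS](markK P).
have := sE a (mark P v); rewrite /= /th markK => ->.
by rewrite unmarkD (additive_mapN _ (@unmarkD P)) /marked_action !unmarkK.
Qed.

Lemma graded_iso_of_intertwiner (P Q : rigid_marking) g h :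
  graded_endo (gpiece V) g -> graded_endo (gpiece V) h ->
  cancel g h -> cancel h g ->
  (forall a v, marked_action P a (g v) = g (marked_action Q a v)) ->
  graded_iso (marked_mod P) (marked_mod Q).
Proof.
move=> [g_lin g_deg] [h_lin h_deg] gK hK gE.
pose f (u : marked_mod P) := mark Q (h (unmark P u)).
have f_lin : linear f.
  move=> a u v; rewrite /f unmarkD -[unmark P (a *: u)]scale1r h_lin scale1r markD.
  congr (_ + _); apply: (can_inj (unmarkK Q)).
  rewrite markK; apply: (can_inj gK); rewrite hK.
  by have := gE a (h (unmark P u)); rewrite hK /marked_action unmarkK => ->.
pose F : {linear marked_mod P -> marked_mod Q} :=
  HB.pack f (GRing.isLinear.Build _ _ _ _ f f_lin).
exists F; split=> [|n u].
  exists (fun w => mark P (g (unmark Q w))) => u; rewrite /F /= /f.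
    by rewrite markK hK unmarkK.
  by rewrite markK gK unmarkK.
rewrite /F /= /f mark_degree -unmark_degree.
by apply/idP/idP => [/g_deg|/h_deg //]; rewrite hK.
Qed.

End Marked.

End GradedModules.
(** * Finiteness of rigid modules of a given type *)

Local Close Scope ring_scope.

Theorem mainTheorem1 (k : closedFieldType) (A : comAlgType k)
    (A_ : nat -> {pred A}) (d : nat) (x : 'I_d -> A) :
  graded_algebra A_ ->
  fin_gen_algebra A ->
  (exists s : seq A, forall a, a \in A_ 0 -> spanned s a) ->
  graded_poly_subring A_ x ->
  module_finite x ->
  isolated_singularity A_ ->
  forall V : gmod (poly_grading A_ x), graded_free V ->
  exists (n : nat) (F : 'I_n -> gmod A_),
    forall M : gmod A_,
      mcm M -> rigid M -> has_type V M ->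
      exists i : 'I_n, graded_iso M (F i).
Proof.
move=> A_gr _ A0_fin x_poly A_fin _ V _.
have [[M0 [[M0_fin _] _ M0_type]]|noM] :=
    classic (exists M : gmod A_, [/\ mcm M, rigid M & has_type V M]); last first.
  have F0 : 'I_0 -> gmod A_ by case.
  exists 0%N, F0 => M ? ? ?.
  by case: noM; exists M.
have [I [z [dz [zP genV]]]] := generators_of_type A_fin M0_fin M0_type.
have [J [y [dy [yP genA]]]] := generators_of_algebra A_gr A_fin.
have V_lin n : (0 \in gpiece V n)%R /\ forall (c : k) u v,
    u \in gpiece V n -> v \in gpiece V n -> (c%:MP *: u + v)%R \in gpiece V n.
  split=> [|c u v un vn]; first exact: piece0 (V_closed V) n.
  by apply: (pieceD (V_closed V)) => //; apply: V_scale.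
have [_ _ _ A_mul] := A_gr.
have [[n0 [b0 B0]] [n1 [b1 B1]] [n2 [b2 B2]]] :=
  multilinear_bases V_lin (V_finite_dim A_gr A0_fin x_poly zP genV) genV zP genA yP.
have [n [F HF]] := rigid_actions_finite V_lin A_mul B0 B1 B2
  (@marked_action_graded _ _ _ _ _ V) (marked_action_rigid A_gr (V := V)).
exists n, (fun i => marked_mod (F i)) => M _ rigM typeM.
have [P <-] := rigid_markingP rigM typeM.
have [i [g [h [g_gr h_gr gK hK gE]]]] := HF P.
by exists i; exact: graded_iso_of_intertwiner g_gr h_gr gK hK gE.
Qed.
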